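(* Let $E$ be a nonzero reflexive real Banach space and let $f,g\colon E\times E^*\to\,]{-}\infty,\infty]$ be proper convex lower semicontinuous BC--functions. Then $\mathrm{dom}\,f+\rho_1\mathrm{dom}\,g=E\times E^*\iff{\cal P}_q(f)+\rho_1{\cal P}_q(g)=E\times E^*$, and $\mathrm{dom}\,f-\rho_1\mathrm{dom}\,g=E\times E^*\iff{\cal P}_q(f)-\rho_1{\cal P}_q(g)=E\times E^*$.
   Context: $\rho_1(x,x^* ):=(-x,x^* )$. $\mathrm{dom}\,f:=\{(x,x^* )\colon f(x,x^* )\in\mathbb{R}\}$. On $E\times E^*$ set $\lfloor(x,x^* ),(y,y^* )\rfloor:=\langle x,y^*\rangle+\langle y,x^*\rangle$ and $q(x,x^* ):=\langle x,x^*\rangle$. For $k$ on $E\times E^*$, $k^@(y,y^* ):=\sup_{(x,x^* )}[\lfloor(x,x^* ),(y,y^* )\rfloor-k(x,x^* )]$; a BC--function is a proper convex $k$ with $k^@\ge k\ge q$; ${\cal P}_q(k):=\{(x,x^* )\colon k(x,x^* )=\langle x,x^*\rangle\}$. *)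

(* Defs.v *)
From HB Require Import structures.
From mathcomp Require Import all_boot all_order all_algebra.
From mathcomp Require Import all_classical all_reals all_analysis.
Set Implicit Arguments. Unset Strict Implicit. Unset Printing Implicit Defensive.
Import Order.TTheory GRing.Theory Num.Theory.
Import numFieldNormedType.Exports.
Local Open Scope classical_set_scope.
Local Open Scope ring_scope.

Section BC.
Context {R : realType} {E : normedModType R}.

Definition is_dual_elt (phi : E -> R) : Prop :=
  (forall (a : R) (x y : E), phi (a *: x + y) = a * phi x + phi y) /\
  continuous phi.

Definition Edual := {phi : E -> R | is_dual_elt phi}.

Definition dual_fun (phi : Edual) : E -> R := proj1_sig phi.

Definition dpair (x : E) (xs : Edual) : R := dual_fun xs x.

Definition opnorm (h : E -> R) : R := sup [set `|h x| | x in [set x : E | `|x| <= 1]].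

Definition pdist (p q : (E * Edual)%type) : R :=
  `|p.1 - q.1| + opnorm (fun z => dual_fun p.2 z - dual_fun q.2 z).

Definition reflexive_space : Prop :=
  forall Phi : Edual -> R,
    (forall (a : R) (phi psi chi : Edual),
        (forall z, dual_fun chi z = a * dual_fun phi z + dual_fun psi z) ->
        Phi chi = a * Phi phi + Phi psi) ->
    (exists C : R, forall phi : Edual, `|Phi phi| <= C * opnorm (dual_fun phi)) ->
    exists x : E, forall phi : Edual, Phi phi = dual_fun phi x.

Local Open Scope ereal_scope.

Definition proper_fun (k : E -> Edual -> \bar R) : Prop :=
  (forall x xs, k x xs != -oo) /\ (exists x xs, k x xs \is a fin_num).

Definition convex_fun (k : E -> Edual -> \bar R) : Prop :=
  forall (t : R) (x y z : E) (xs ys zs : Edual), (0 < t < 1)%R ->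
    z = (t *: x + (1 - t) *: y)%R ->
    (forall w, dual_fun zs w = t * dual_fun xs w + (1 - t) * dual_fun ys w)%R ->
    k z zs <= t%:E * k x xs + (1 - t)%:E * k y ys.

Definition lsc_fun (k : E -> Edual -> \bar R) : Prop :=
  forall (x : E) (xs : Edual) (a : R), a%:E < k x xs ->
    exists2 e : R, (0 < e)%R & forall (y : E) (ys : Edual),
      (pdist (y, ys) (x, xs) < e)%R -> a%:E < k y ys.

Definition qf (x : E) (xs : Edual) : R := dpair x xs.

Definition at_conj (k : E -> Edual -> \bar R) (y : E) (ys : Edual) : \bar R :=
  ereal_sup [set ((dpair x ys + dpair y xs)%R)%:E - k x xs | x in [set: E] & xs in [set: Edual]].

Definition BC_function (k : E -> Edual -> \bar R) : Prop :=
  proper_fun k /\ convex_fun k /\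
  (forall x xs, k x xs <= at_conj k x xs) /\
  (forall x xs, (qf x xs)%:E <= k x xs).

Definition domf (k : E -> Edual -> \bar R) : set ((E * Edual)%type) :=
  [set p | k p.1 p.2 \is a fin_num].

Definition Pq (k : E -> Edual -> \bar R) : set ((E * Edual)%type) :=
  [set p | k p.1 p.2 = (qf p.1 p.2)%:E].

Local Close Scope ereal_scope.

(* A + rho_1 B = E x E^star, with rho_1 (y, y^star) = (-y, y^star) *)
Definition sum_rho1_full (A B : set ((E * Edual)%type)) : Prop :=
  forall (a : E) (as_ : Edual), exists p q, A p /\ B q /\
    a = p.1 - q.1 /\ forall z, dual_fun as_ z = dual_fun p.2 z + dual_fun q.2 z.

Definition diff_rho1_full (A B : set ((E * Edual)%type)) : Prop :=
  forall (a : E) (as_ : Edual), exists p q, A p /\ B q /\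
    a = p.1 + q.1 /\ forall z, dual_fun as_ z = dual_fun p.2 z - dual_fun q.2 z.

End BC.

(* Main.v *)
Require Import Defs.
From HB Require Import structures.
From mathcomp Require Import all_boot all_order all_algebra.
From mathcomp Require Import all_classical all_reals all_analysis.
From mathcomp Require Import lra ring.
Import Order.TTheory GRing.Theory Num.Theory.
Import numFieldNormedType.Exports.
Local Open Scope classical_set_scope.
Local Open Scope ring_scope.

(** If [p = (x, x')] and [q = (w, w')] satisfy [p + rho_1 q = (a, a')], then
    [<x, x'> + <w, w'>] is the affine function [<x, a'> + <a, x'> - <a, a'>]
    of [p], so [f p + g q] minus this function is nonnegative under the
    constraint [p + rho_1 q = (a, a')].  When [dom f + rho_1 dom g] is the whole
    space, this convex program has a continuous multiplier (Hahn-Banach on a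
    convex cone, with continuity from Baire and a convex-series argument on
    [epi f x epi g]), which by reflexivity is a point [(y, y')].  It produces
    [p] and [q] with [p + rho_1 q = (a, a')] for which the sum of the conjugates
    of [f] at [p] and of [g] at [q] is at most [<p> + <q>], where [<p>] is the
    duality pairing of the two components.  As the conjugates dominate [f] and
    [g], which dominate the pairing, [p] lies in [Pq f] and [q] in [Pq g].
    The two equivalences are the cases [e = 1] and [e = -1] of one statement
    whose proof uses only [e * e = 1]. *)

(** * Hahn-Banach for convex cones *)

(** A pair [(x, r)] is read as a bound [xi x <= r] imposed on a functional [xi] to be found. Only
    positive multiples are required, so the origin may be missing. *)
Definition convex_cone {R : realType} {V : lmodType R} (S : set (V * R)) :=
  (forall x y r s, S (x, r) -> S (y, s) -> S (x + y, r + s)) /\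
  (forall t x r, 0 < t -> S (x, r) -> S (t *: x, t * r)).

Lemma maximal_convex_cone (R : realType) (V : lmodType R) (S0 : set (V * R)) :
  convex_cone S0 -> (forall r, S0 (0, r) -> 0 <= r) ->
  exists S, [/\ S0 `<=` S, convex_cone S, (forall r, S (0, r) -> 0 <= r) &
    forall S', S `<=` S' -> convex_cone S' ->
      (forall r, S' (0, r) -> 0 <= r) -> S' `<=` S].
Proof.
move=> S0cone S0pos.
(* Zorn's lemma is applied to the part [A] added to [S0], so that the empty chain, whose union is
   empty, causes no trouble. *)
pose P := [set A | convex_cone (S0 `|` A) /\
  forall r, (S0 `|` A) (0, r) -> 0 <= r].
have [|A [[Acone Apos] Amax]] := @Zorn_bigcup (V * R)%type P.
  move=> F FP Ftot.
  have common p q : (S0 `|` \bigcup_(X in F) X) p ->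
      (S0 `|` \bigcup_(X in F) X) q ->
      exists B, [/\ convex_cone (S0 `|` B), (S0 `|` B) p, (S0 `|` B) q &
        (S0 `|` B) `<=` S0 `|` \bigcup_(X in F) X].
    have sub B : F B -> (S0 `|` B) `<=` S0 `|` \bigcup_(X in F) X.
      by move=> FB z [zS|zB]; [left|right; exists B].
    case=> [pS|[B FB pB]]; case=> [qS|[C FC qC]].
    - by exists set0; rewrite setU0; split => // z; left.
    - exists C; split; [exact: (FP _ FC).1|by left|by right|exact: sub].
    - exists B; split; [exact: (FP _ FB).1|by right|by left|exact: sub].
    - have [BC|CB] := Ftot _ _ FB FC.
      + exists C; split; [exact: (FP _ FC).1|by right; apply: BC|by right|exact: sub].
      + exists B; split; [exact: (FP _ FB).1|by right|by right; apply: CB|exact: sub].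
  split; first split.
  - move=> x y r s Sx Sy; have [B [[BD _] Bx By sB]] := common _ _ Sx Sy.
    by apply: sB; apply: BD.
  - move=> t x r t0 Sx; have [B [[_ BZ] Bx _ sB]] := common _ _ Sx Sx.
    by apply: sB; apply: BZ.
  - by move=> r [/S0pos//|[B FB B0]]; apply: (FP _ FB).2; right.
exists (S0 `|` A); split; [by move=> z; left|exact: Acone|exact: Apos|].
move=> S' sub S'cone S'pos z S'z; apply: contrapT => nz.
have S0S' : S0 `|` S' = S' by apply: setUidr => u S0u; apply: sub; left.
apply: (Amax S'); last by (split; rewrite S0S').
split; first by move=> u Au; apply: sub; right.
by move=> S'A; apply: nz; right; apply: S'A.
Qed.

(* The lower envelope [p] of a maximal cone is sublinear.  It satisfies
   [p (- z) <= - p z], since otherwise the ray through [(- z, - p z)] could be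
   adjoined to the cone; being odd, it is then linear. *)
Lemma convex_cone_linear_minorant (R : realType) (V : lmodType R)
    (S0 : set (V * R)) :
  convex_cone S0 -> (forall x, exists r, S0 (x, r)) ->
  (forall r, S0 (0, r) -> 0 <= r) ->
  exists xi : {scalar V}, forall x r, S0 (x, r) -> xi x <= r.
Proof.
move=> S0cone S0full S0pos.
have [S [S0S [SD SZ] Spos Smax]] := @maximal_convex_cone R V S0 S0cone S0pos.
have Sfull x : exists r, S (x, r) by have [r /S0S ?] := S0full x; exists r.
pose p x := inf [set r | S (x, r)].
have pne x : [set r | S (x, r)] !=set0 by have [r Sr] := Sfull x; exists r.
(* Adding a pair over [- x] to a pair over [x] gives a pair over [0], whose height is
   nonnegative. *)
have plb x : has_lbound [set r | S (x, r)].
  have [s Ss] := Sfull (- x); exists (- s) => r /= Sr.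
  by rewrite -subr_ge0 opprK; apply: Spos; rewrite -(subrr x); apply: SD.
have p_le x r : S (x, r) -> p x <= r by move=> Sr; apply: ge_inf.
have le_p x c : (forall r, S (x, r) -> c <= r) -> c <= p x.
  by move=> H; apply: lb_le_inf.
have pD x y : p (x + y) <= p x + p y.
  rewrite -lerBlDr; apply: (le_p) => r Sr; rewrite lerBlDr -lerBlDl.
  by apply: (le_p) => s Ss; rewrite lerBlDl; apply: (p_le); apply: SD.
have pZ_le t x : 0 < t -> p (t *: x) <= t * p x.
  move=> t0; rewrite -ler_pdivrMl//; apply: (le_p) => r Sr.
  by rewrite ler_pdivrMl//; apply: (p_le); apply: SZ.
have pZ t x : 0 < t -> p (t *: x) = t * p x.
  move=> t0; apply/eqP; rewrite eq_le pZ_le//= -ler_pdivlMl//.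
  have := pZ_le t^-1 (t *: x); rewrite scalerA mulVf ?gt_eqF// scale1r.
  by apply; rewrite invr_gt0.
have p0 : p 0 = 0.
  by have := pZ 2 0 ltac:(by []); rewrite scaler0; lra.
have pN_le z : p (- z) <= - p z.
  (* The alternative [(x, r) = 0] puts the new ray itself into [S'], as [S] is not known to contain
     the origin. *)
  pose S' := [set u : V * R | exists x r t,
    [/\ S (x, r) \/ (x, r) = 0, 0 <= t & u = (x - t *: z, r - t * p z)]].
  have subS' : S `<=` S'.
    move=> [x r] Sx; exists x, r, 0; split => //; first by left.
    by rewrite scale0r mul0r !subr0.
  apply: (p_le); apply: (Smax S') => //; first split.
  - move=> x y r s [x1 [r1 [t1 [S1 t10 [-> ->]]]]] [x2 [r2 [t2 [S2 t20 [-> ->]]]]].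
    exists (x1 + x2), (r1 + r2), (t1 + t2); split; [|exact: addr_ge0|].
      case: S1 => [S1|[-> ->]]; last by rewrite !add0r.
      by case: S2 => [S2|[-> ->]]; [left; exact: SD|rewrite !addr0; left].
    by congr pair; [rewrite scalerDl opprD addrACA|rewrite mulrDl opprD addrACA].
  - move=> s x r s0 [x1 [r1 [t1 [S1 t10 [-> ->]]]]].
    exists (s *: x1), (s * r1), (s * t1); split; [|by rewrite mulr_ge0// ltW|].
      case: S1 => [S1|[-> ->]]; first by left; exact: SZ.
      by right; rewrite scaler0 mulr0.
    by rewrite scalerBr scalerA mulrBr mulrA.
  (* Over the origin [x1 = t1 *: z], hence [r1 >= p (t1 *: z) = t1 * p z] when [t1 > 0]. *)
  - move=> r [x1 [r1 [t1 [S1 t10 [/esym/subr0_eq x1E ->]]]]]; rewrite subr_ge0.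
    case: S1 => [S1|[x10 ->]].
      move: t10; rewrite le_eqVlt => /predU1P[t10|t10].
        by move: S1; rewrite x1E -t10 scale0r mul0r; exact: Spos.
      by rewrite -pZ//; apply: (p_le); rewrite -x1E.
    move: t10; rewrite le_eqVlt => /predU1P[<-|t10]; first by rewrite mul0r.
    by rewrite -pZ// -x1E x10 p0.
  - exists 0, 0, 1; split => //; first by right.
    by rewrite scale1r mul1r !sub0r.
have pN z : p (- z) = - p z.
  apply/eqP; rewrite eq_le pN_le/= -subr_ge0 opprK.
  by have := pD (- z) z; rewrite addNr p0.
have pDE x y : p (x + y) = p x + p y.
  apply/eqP; rewrite eq_le pD/=.
  by have := pD (x + y) (- y); rewrite addrK pN lerBrDr.
have pZE t x : p (t *: x) = t * p x.
  have [t0|t0|->] := ltgtP t 0; last by rewrite scale0r p0 mul0r.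
    by apply: oppr_inj; rewrite -pN -scaleNr -mulNr pZ// oppr_gt0.
  exact: pZ.
have plin : scalar p by move=> t x y; rewrite pDE pZE.
pose xi : {scalar V} := HB.pack p (GRing.isLinear.Build _ _ _ _ _ plin).
by exists xi => x r /S0S; exact: p_le.
Qed.

(** * Images of closed convex sets *)

(** The first [n] weights sum to [1 - 2^-n]. Giving the missing mass to a point of [K] turns a
    partial sum into a true convex combination, and this correction vanishes in the limit because
    [K] is bounded or, as here, the point is fixed. *)
Lemma dyadic_series_in_closed_convex (R : realType) (Y : completeNormedModType R)
    (K : set Y) (M : R) (k : nat -> Y) :
  closed K -> (forall x y, K x -> K y -> K (2^-1 *: x + 2^-1 *: y)) ->
  (forall y, K y -> `|y| <= M) -> (forall i, K (k i)) ->
  exists2 w, K w & series (fun i => 2^-1 ^+ i.+1 *: k i) @ \oo --> w.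
Proof.
move=> Kcl Kmid Kbd Kk.
pose u i := 2^-1 ^+ i.+1 *: k i.
have ucvg : cvgn (series u).
  apply: normed_cvg.
  apply: (@series_le_cvg _ _ (geometric (2^-1 * M) 2^-1)) => [n|n|n|] /=.
  - exact: normr_ge0.
  - by rewrite !mulr_ge0 ?exprn_ge0 ?invr_ge0//; apply: le_trans (Kbd _ (Kk 0%N)).
  - rewrite /u normrZ ger0_norm ?exprn_ge0 ?invr_ge0//.
    rewrite exprS mulrAC -[X in _ <= X]/(2^-1 * M * 2^-1 ^+ n).
    by rewrite ler_wpM2r ?exprn_ge0 ?invr_ge0// ler_wpM2l ?invr_ge0// Kbd.
  - by apply: is_cvg_geometric_series; rewrite ger0_norm ?invr_ge0// invf_lt1// ltr1n.
exists (limn (series u)); last exact: ucvg.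
(* The induction is for all [y]: the mass left on [y] is split equally between [k n] and [y], that
   is, [y] is replaced by a midpoint. *)
have Kpartial n y : K y -> K (series u n + 2^-1 ^+ n *: y).
  elim: n y => [|n IHn] y Ky; first by rewrite /series/= big_geq// add0r expr0 scale1r.
  have := IHn _ (Kmid _ _ (Kk n) Ky).
  by rewrite scalerDr !scalerA -exprSr addrA seriesSr.
apply: (@closed_cvg _ _ \oo _ (fun n => series u n + 2^-1 ^+ n *: k 0%N) K) => //.
  by apply: nearW => n; apply: Kpartial.
rewrite -[X in _ --> X]addr0 -(scale0r (k 0%N)).
apply: cvgD => //; apply: cvgZl; apply: cvg_expr.
by rewrite ger0_norm ?invr_ge0// invf_lt1// ltr1n.
Qed.

Definition segment_closed {R : realType} {V : lmodType R} (K : set V) :=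
  forall t x y, 0 < t < 1 -> K x -> K y -> K (t *: x + (1 - t) *: y).

(** Otherwise all the complements are open and dense, and by Baire they share a point, which no
    [D n] covers. *)
Lemma baire_ball (R : realType) (X : completeNormedModType R) (D : nat -> set X) :
  (forall n, closed (D n)) -> (forall x, exists n, D n x) ->
  exists n x0, exists2 r : R, 0 < r & forall x, `|x - x0| < r -> D n x.
Proof.
move=> Dcl Dcover.
have : ~ forall n, open (~` D n) /\ dense (~` D n).
  move=> /Baire /(_ setT) [||x []].
  - by exists 0.
  - exact: openT.
  - by have [n Dnx] := Dcover x => _ /(_ n I); apply.
move=> /existsNP[n /not_andP[|]]; first by case; rewrite openC.
move=> /denseNE[U [[x0 [Uo Ux0]] UD]].
have /nbhs_ballP[r r0 rU] : nbhs x0 U by apply: open_nbhs_nbhs.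
exists n, x0, r => // x xr; apply: contrapT => nDx.
suff : (U `&` ~` D n) x by rewrite UD.
by split => //; apply: rU; rewrite -ball_normE /ball_/= distrC.
Qed.

(* Successive halving: a point [x] of the ball is a dyadic average of a point of
   the image and of another point of the ball, and iterating this expresses [x]
   as the image of a convergent convex series. *)
Lemma closed_convex_image_ball (R : realType) (Y X : completeNormedModType R)
    (T : {linear Y -> X}) (K : set Y) :
  continuous T -> closed K -> segment_closed K ->
  (forall x, exists2 y, K y & T y = x) ->
  exists x0 M, exists2 r : R, 0 < r &
    forall x, `|x - x0| < r -> exists y, [/\ K y, `|y| <= M & T y = x].
Proof.
move=> Tc Kcl Kcv Tfull.
pose KM M := K `&` [set y | `|y| <= M].
have [n|x|n [x0 [r r0 ball_cl]]] :=
    @baire_ball R X (fun n => closure (T @` KM n%:R)).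
- exact: closed_closure.
- have [y Ky <-] := Tfull x; exists (Num.bound `|y|); apply: subset_closure.
  exists y => //; split => //=; apply: ltW.
  by have := archi_boundP (normr_ge0 y).
set M : R := n%:R in ball_cl; exists x0, M, (r / 2); first by rewrite divr_gt0.
(* For [x] within [r / 2] of [x0], the point [2 *: x - x0] is within [r] of [x0]. Approximating it
   by [T y] up to [r / 2] keeps [2 *: x - T y] in the half ball. Outside that ball [y = 0] is a
   dummy value, which lets [choice] give a total function. *)
have near_image x : exists y, `|x - x0| < r / 2 ->
    KM M y /\ `|2 *: x - T y - x0| < r / 2.
  have [xr|_] := boolP (`|x - x0| < r / 2); last by exists 0.
  have /ball_cl : `|(2 *: x - x0) - x0| < r.
    have -> : (2 *: x - x0) - x0 = 2 *: (x - x0).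
      by rewrite scalerBr [2 *: x0]scaler_nat mulr2n opprD addrA.
    rewrite normrZ ger0_norm//.
    by rewrite mulrC -ltr_pdivlMr.
  move=> /(_ (ball (2 *: x - x0) (r / 2)) _) [|_ [[y Ky <-] ]].
    by apply: nbhsx_ballx; rewrite divr_gt0.
  rewrite -ball_normE /ball_/= => yr; exists y => _; split => //.
  by rewrite addrAC.
have [step stepP] := choice near_image.
move=> x xr; pose z : nat -> X := fun i => iter i (fun x : X => 2 *: x - T (step x)) x.
have zr i : `|z i - x0| < r / 2.
  elim: i => [//|i IHi]; rewrite /z iterS -/(z i); exact: (stepP _ IHi).2.
have Kz i : KM M (step (z i)) by exact: (stepP _ (zr i)).1.
have KMcl : closed (KM M).
  apply: closedI => //;
    apply: (@preimage_closed _ _ (fun y : Y => `|y|) [set s | s <= M]).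
    by move=> y _; exact: norm_continuous.
  exact: closed_le.
have KMmid y1 y2 : KM M y1 -> KM M y2 -> KM M (2^-1 *: y1 + 2^-1 *: y2).
  move=> [K1 M1] [K2 M2]; split.
    have -> : 2^-1 *: y2 = (1 - 2^-1) *: y2 by congr (_ *: _); lra.
    by apply: Kcv => //; lra.
  rewrite /= (le_trans (ler_normD _ _))// !normrZ !ger0_norm ?invr_ge0//.
  by move: M1 M2 => /=; lra.
have [w [Kw Mw] wlim] := @dyadic_series_in_closed_convex R Y (KM M) M
  (fun i => step (z i)) KMcl KMmid (fun y Ky => Ky.2) Kz.
exists w; split => //.
(* The sum telescopes, since [z i] is the midpoint of [T (step (z i))] and [z i.+1]. The remainder
   tends to [0] because every [z i] stays in the half ball. *)
have Tsum i : T (series (fun i => 2^-1 ^+ i.+1 *: step (z i)) i)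
    = x - 2^-1 ^+ i *: z i.
  elim: i => [|i IHi]; first by rewrite /series/= big_geq// linear0 expr0 scale1r subrr.
  have -> : z i.+1 = 2 *: z i - T (step (z i)) by [].
  rewrite seriesSr linearD IHi [T (_ *: _)]linearZ/= scalerBr scalerA exprSr.
  by rewrite -[in 2^-1 ^+ i * _ * 2]mulrA mulVf// mulr1 opprB -addrA;
    congr (_ + _); rewrite addrC.
have Twlim : x - 2^-1 ^+ i *: z i @[i --> \oo] --> T w.
  rewrite -(funext Tsum); apply: continuous_cvg wlim; exact: Tc.
apply: (cvg_unique (@norm_hausdorff _ X) Twlim).
rewrite /= -[X in _ --> X]subr0; apply: cvgB; first exact: cvg_cst.
apply/norm_cvg0P.
apply: (@squeeze_cvgr _ _ _ _ (fun=> 0) (fun i => 2^-1 ^+ i * (r / 2 + `|x0|))).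
- apply: nearW => i; rewrite normr_ge0/= normrZ ger0_norm ?exprn_ge0 ?invr_ge0//.
  rewrite ler_wpM2l ?exprn_ge0 ?invr_ge0// -[z i](subrK x0).
  by rewrite (le_trans (ler_normD _ _))// lerD2r ltW.
- exact: cvg_cst.
- rewrite -[X in _ --> X](mul0r (r / 2 + `|x0|)); apply: cvgMl.
  by apply: cvg_expr; rewrite ger0_norm ?invr_ge0// invf_lt1// ltr1n.
Qed.

(** Translation moves the ball to the origin, homogeneity extends the bound to all vectors, and
    applying it to [- x] makes it two-sided. *)
Lemma bounded_above_ball_scalar (R : realType) (X : normedModType R)
    (xi : {scalar X}) (x0 : X) (r M : R) :
  0 < r -> (forall x, `|x - x0| < r -> xi x <= M) ->
  exists C, forall x, `|xi x| <= C * `|x|.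
Proof.
move=> r0 xiM; pose N := M - xi x0; exists (N * (2 / r)).
have small h : `|h| < r -> xi h <= N.
  by move=> hr; rewrite lerBrDr -raddfD; apply: xiM; rewrite addrK.
have le_xi x : xi x <= N * (2 / r) * `|x|.
  have [->|x_neq0] := eqVneq x 0; first by rewrite raddf0 normr0 mulr0.
  have nx : 0 < `|x| by rewrite normr_gt0.
  (* With this [t], the vector [t^-1 *: x] has norm [r / 2], strictly inside the ball. *)
  pose t := 2 / r * `|x|; have t0 : 0 < t by rewrite mulr_gt0// divr_gt0.
  have : xi (t^-1 *: x) <= N.
    apply: small; rewrite normrZ gtr0_norm ?invr_gt0// mulrC ltr_pdivrMr//.
    by rewrite /t mulrA mulrCA divff ?gt_eqF// mulr1 ltr_pMl// ltr1n.
  by rewrite linearZ/= -mulrA -/t ler_pdivrMl// mulrC.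
move=> x; rewrite ler_norml le_xi andbT lerNl -raddfN -(normrN x); exact: le_xi.
Qed.

Lemma continuous_scalar_bound (R : realType) (Y : normedModType R)
    (phi : {scalar Y}) : continuous phi ->
  exists2 C, 0 <= C & forall y, `|phi y| <= C * `|y|.
Proof.
move=> phic.
have /nbhs_ballP[r /= r0 phi1] : \forall y \near 0, phi y < 1.
  by apply: (cvgr_lt (phi 0) (phic 0)); rewrite raddf0.
have [C phiC] : exists C, forall y, `|phi y| <= C * `|y|.
  apply: (@bounded_above_ball_scalar R Y phi 0 r 1 r0) => y yr; apply/ltW/phi1.
  by rewrite -ball_normE /ball_/= distrC.
exists `|C| => // y; apply: (le_trans (phiC y)).
by rewrite ler_wpM2r// ler_norm.
Qed.

(** [xi] is a Lagrange multiplier for minimizing [phi] on [K] under [T y = x0]. It is a linear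
    minorant of the cone generated by the pairs [(T y - x0, phi y - c)]. It is continuous because
    the points of some ball are images of points of [K] of bounded norm, which bounds [xi] above
    there. *)
Lemma closed_convex_multiplier (R : realType) (Y X : completeNormedModType R)
    (T : {linear Y -> X}) (phi : {scalar Y}) (K : set Y) (x0 : X) (c : R) :
  continuous T -> continuous phi -> closed K -> segment_closed K ->
  (forall x, exists2 y, K y & T y = x) ->
  (forall y, K y -> T y = x0 -> c <= phi y) ->
  exists2 xi : {scalar X}, (exists C, forall x, `|xi x| <= C * `|x|) &
    forall y, K y -> xi (T y - x0) <= phi y - c.
Proof.
move=> Tc phic Kcl Kcv Tfull Kpos.
(* Here [t] is the inverse of the scaling factor: [u] is [(T y - x0, phi y - c)] divided by [t]. *)
pose S := [set u : X * R | exists y t, [/\ K y, 0 < t,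
  T y = x0 + t *: u.1 & phi y = c + t * u.2]].
have [|x|r|xi xi_le] := @convex_cone_linear_minorant R X S.
- split.
    move=> x1 x2 r1 r2 [y1 [t1 [K1 t10 /= T1 p1]]] [y2 [t2 [K2 t20 /= T2 p2]]].
    have t120 : 0 < t1 + t2 by exact: addr_gt0.
    have t12n : t1 + t2 != 0 by rewrite gt_eqF.
    have lamC : 1 - t2 / (t1 + t2) = t1 / (t1 + t2) by field.
    have lam1 : t2 / (t1 + t2) * t1 = t1 * t2 / (t1 + t2) by field.
    have lam2 : t1 / (t1 + t2) * t2 = t1 * t2 / (t1 + t2) by field.
    (* The scaling factors [t1^-1] and [t2^-1] add up to the inverse of the new [t], and the convex
       weights are their shares of this sum. *)
    exists (t2 / (t1 + t2) *: y1 + (1 - t2 / (t1 + t2)) *: y2), (t1 * t2 / (t1 + t2)).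
    split => /=.
    + apply: Kcv => //; rewrite divr_gt0//= ltr_pdivrMr// mul1r.
      by rewrite ltrDr.
    + by rewrite divr_gt0// mulr_gt0.
    + rewrite lamC linearD !linearZ/= T1 T2 !scalerDr !scalerA lam1 lam2 addrACA.
      have lamD : t2 / (t1 + t2) + t1 / (t1 + t2) = 1 by field.
      by rewrite -scalerDl lamD scale1r -scalerDr.
    + rewrite lamC linearD !linearZ/= p1 p2; field.
      by [].
  move=> s x r s0 [y [t [Ky t0 /= Ty py]]].
  exists y, (t / s); split => //=; first exact: divr_gt0.
    by rewrite scalerA divfK ?gt_eqF.
  by rewrite mulrA divfK ?gt_eqF.
- have [y Ky Ty] := Tfull (x0 + x); exists (phi y - c), y, 1; split => //=.
    by rewrite scale1r.
  by rewrite mul1r addrC subrK.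
- move=> [y [t [Ky t0 /= Ty py]]]; move: Ty; rewrite scaler0 addr0 => Ty.
  by have := Kpos y Ky Ty; rewrite py lerDl pmulr_rge0.
have xiK y : K y -> xi (T y - x0) <= phi y - c.
  move=> Ky; apply: xi_le; exists y, 1; split => //=.
    by rewrite scale1r addrC subrK.
  by rewrite mul1r addrC subrK.
exists xi => //.
have [z0 [M [r r0 ballK]]] := @closed_convex_image_ball R Y X T K Tc Kcl Kcv Tfull.
have [C C0 phiC] := @continuous_scalar_bound R Y phi phic.
apply: (@bounded_above_ball_scalar R X xi z0 r (C * M - c + xi x0) r0) => x xr.
have [y [Ky yM <-]] := ballK x xr.
rewrite -lerBlDr -raddfB; apply: (le_trans (xiK y Ky)); rewrite lerB//.
by rewrite (le_trans (ler_norm _))// (le_trans (phiC y))// ler_wpM2l.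
Qed.

(** * The dual as a Banach space *)

Section dual_space.
Context {R : realType} {E : normedModType R}.
Implicit Types phi psi : @Edual R E.

Lemma dual_fun_inj phi psi : dual_fun phi =1 dual_fun psi -> phi = psi.
Proof.
case: phi psi => [f fP] [g gP] /= /funext fg; rewrite -fg in gP *.
by congr exist; exact: Prop_irrelevance.
Qed.

Lemma dual_fun_scalar phi : scalar (dual_fun phi).
Proof. exact: (proj2_sig phi).1. Qed.

Definition dual_scalar phi : {scalar E} :=
  HB.pack (dual_fun phi) (GRing.isLinear.Build _ _ _ _ _ (dual_fun_scalar phi)).

Lemma dual_fun0 phi : dual_fun phi 0 = 0.
Proof. exact: (raddf0 (dual_scalar phi)). Qed.

Lemma dual_funD phi x y : dual_fun phi (x + y) = dual_fun phi x + dual_fun phi y.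
Proof. exact: (raddfD (dual_scalar phi)). Qed.

Lemma dual_funN phi x : dual_fun phi (- x) = - dual_fun phi x.
Proof. exact: (raddfN (dual_scalar phi)). Qed.

Lemma dual_funZ phi a x : dual_fun phi (a *: x) = a * dual_fun phi x.
Proof. exact: (scalarZ (dual_scalar phi)). Qed.

Lemma dual_fun_continuous phi : continuous (dual_fun phi).
Proof. exact: (proj2_sig phi).2. Qed.

Lemma dual_eltP (xi : {scalar E}) (C : R) :
  (forall x, `|xi x| <= C * `|x|) -> is_dual_elt xi.
Proof.
move=> xiC; split; first exact: linearP.
have C1 : 0 < `|C| + 1 by rewrite ltr_wpDl.
move=> x; apply/cvgrPdist_lt => e e0; near=> y; rewrite -raddfB.
rewrite (le_lt_trans (xiC _))// (@le_lt_trans _ _ ((`|C| + 1) * `|x - y|))//.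
  by rewrite ler_wpM2r// (le_trans (ler_norm C))// lerDl.
rewrite -ltr_pdivlMl//; near: y; apply: cvgr_dist_lt => //.
by rewrite mulr_gt0// invr_gt0.
Unshelve. all: by end_near. Qed.

Lemma dual_funD_subproof phi psi :
  is_dual_elt (fun z => dual_fun phi z + dual_fun psi z).
Proof.
split=> [a x y|x].
  by rewrite !(dual_fun_scalar _ a) addrACA mulrDr.
by apply: cvgD; exact: dual_fun_continuous.
Qed.

Lemma dual_funZ_subproof (a : R) phi : is_dual_elt (fun z => a * dual_fun phi z).
Proof.
split=> [b x y|x]; first by rewrite (dual_fun_scalar _ b) mulrDr mulrCA.
by apply: cvgMr; exact: dual_fun_continuous.
Qed.

Lemma dual_funN_subproof phi : is_dual_elt (fun z => - dual_fun phi z).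
Proof.
split=> [b x y|x]; first by rewrite (dual_fun_scalar _ b) opprD mulrN.
by apply: cvgN; exact: dual_fun_continuous.
Qed.

Lemma dual_fun0_subproof : is_dual_elt (fun _ : E => 0 : R).
Proof. by split=> [b x y|x]; [rewrite mulr0 addr0|exact: cvg_cst]. Qed.

Definition dual_add phi psi : @Edual R E := exist _ _ (dual_funD_subproof phi psi).
Definition dual_opp phi : @Edual R E := exist _ _ (dual_funN_subproof phi).
Definition dual_zero : @Edual R E := exist _ _ dual_fun0_subproof.
Definition dual_scale (a : R) phi : @Edual R E := exist _ _ (dual_funZ_subproof a phi).

Fact dual_addA : associative dual_add.
Proof. by move=> x y z; apply: dual_fun_inj => u; rewrite /= addrA. Qed.
Fact dual_addC : commutative dual_add.
Proof. by move=> x y; apply: dual_fun_inj => u; rewrite /= addrC. Qed.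
Fact dual_add0 : left_id dual_zero dual_add.
Proof. by move=> x; apply: dual_fun_inj => u; rewrite /= add0r. Qed.
Fact dual_addN : left_inverse dual_zero dual_opp dual_add.
Proof. by move=> x; apply: dual_fun_inj => u; rewrite /= addNr. Qed.

HB.instance Definition _ := gen_eqMixin (@Edual R E).
HB.instance Definition _ := gen_choiceMixin (@Edual R E).
HB.instance Definition _ := GRing.isZmodule.Build (@Edual R E)
  dual_addA dual_addC dual_add0 dual_addN.

Fact dual_scaleA a b phi : dual_scale a (dual_scale b phi) = dual_scale (a * b) phi.
Proof. by apply: dual_fun_inj => u; rewrite /= mulrA. Qed.
Fact dual_scale1 : left_id 1 dual_scale.
Proof. by move=> phi; apply: dual_fun_inj => u; rewrite /= mul1r. Qed.
Fact dual_scaleDr : right_distributive dual_scale +%R.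
Proof. by move=> a phi psi; apply: dual_fun_inj => u; rewrite /= mulrDr. Qed.
Fact dual_scaleDl phi : {morph dual_scale^~ phi : a b / a + b}.
Proof. by move=> a b; apply: dual_fun_inj => u; rewrite /= mulrDl. Qed.

HB.instance Definition _ := GRing.Zmodule_isLmodule.Build R (@Edual R E)
  dual_scaleA dual_scale1 dual_scaleDr dual_scaleDl.

(** Needed for the [sup] in [opnorm] to be a genuine least upper bound. *)
Lemma dual_fun_has_ubound phi :
  has_ubound [set `|dual_fun phi x| | x in [set x : E | `|x| <= 1]].
Proof.
have [C C0 phiC] :=
  @continuous_scalar_bound R E (dual_scalar phi) (dual_fun_continuous phi).
exists C => _ [y /= y1 <-]; rewrite (le_trans (phiC y))//.
by rewrite -[leRHS]mulr1 ler_wpM2l.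
Qed.

Lemma dual_fun_opnorm phi x : `|dual_fun phi x| <= opnorm (dual_fun phi) * `|x|.
Proof.
have [->|x0] := eqVneq x 0.
  by rewrite dual_fun0 !normr0 mulr0.
have nx : 0 < `|x| by rewrite normr_gt0.
have nxV : `|(`|x|^-1)| = `|x|^-1 by rewrite ger0_norm// invr_ge0.
rewrite -ler_pdivrMr// mulrC -[X in X * _]nxV -normrM -dual_funZ.
apply: ub_le_sup; first exact: dual_fun_has_ubound.
by exists (`|x|^-1 *: x) => //=; rewrite normrZ nxV mulVf// gt_eqF.
Qed.

Lemma opnorm_le (h : E -> R) (C : R) :
  0 <= C -> (forall x, `|h x| <= C * `|x|) -> opnorm h <= C.
Proof.
move=> C0 hC; apply: ge_sup; first by exists `|h 0|, 0; rewrite //= normr0.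
move=> _ [x /= x1 <-]; rewrite (le_trans (hC x))//.
by rewrite -[leRHS]mulr1 ler_wpM2l.
Qed.

Lemma opnorm_ge0 phi : 0 <= opnorm (dual_fun phi).
Proof.
apply: (@le_trans _ _ `|dual_fun phi 0|); first exact: normr_ge0.
apply: ub_le_sup; first exact: dual_fun_has_ubound.
by exists 0; rewrite //= normr0.
Qed.

(** This is the norm that [pdist] uses on the second component, so that [lsc_fun] can be compared
    with the product topology. *)
Definition dual_norm phi := opnorm (dual_fun phi).

Fact dual_normD phi psi : dual_norm (phi + psi) <= dual_norm phi + dual_norm psi.
Proof.
apply: opnorm_le => [|x]; first by rewrite addr_ge0// opnorm_ge0.
by rewrite mulrDl (le_trans (ler_normD _ _))// lerD// dual_fun_opnorm.
Qed.

Fact dual_normZ (a : R) phi : dual_norm (a *: phi) = `|a| * dual_norm phi.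
Proof.
have le_norm b psi : dual_norm (b *: psi) <= `|b| * dual_norm psi.
  apply: opnorm_le => [|x]; first by rewrite mulr_ge0// opnorm_ge0.
  by rewrite normrM -mulrA ler_wpM2l// dual_fun_opnorm.
have [->|a0] := eqVneq a 0.
  apply/eqP; rewrite normr0 mul0r eq_le opnorm_ge0 andbT.
  by have := le_norm 0 phi; rewrite normr0 mul0r.
apply/eqP; rewrite eq_le le_norm/= -ler_pdivlMl ?normr_gt0//.
by have := le_norm a^-1 (a *: phi); rewrite scalerA mulVf// scale1r normfV.
Qed.

Fact dual_norm0_eq0 phi : dual_norm phi = 0 -> phi = 0.
Proof.
move=> phi0; apply: dual_fun_inj => x; apply/normr0_eq0/eqP.
rewrite eq_le normr_ge0 andbT (le_trans (dual_fun_opnorm _ _))//.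
by rewrite -/(dual_norm phi) phi0 mul0r.
Qed.

HB.instance Definition _ := Lmodule_isNormed.Build R (@Edual R E)
  dual_normD dual_normZ dual_norm0_eq0.

Lemma dual_fun_le phi x : `|dual_fun phi x| <= `|phi| * `|x|.
Proof. exact: dual_fun_opnorm. Qed.

Lemma dual_norm_le phi C : 0 <= C -> (forall x, `|dual_fun phi x| <= C * `|x|) ->
  `|phi| <= C.
Proof. exact: opnorm_le. Qed.

End dual_space.

(** Evaluations are Lipschitz, so a Cauchy filter has a linear pointwise limit. Where the filter
    contains a ball of radius [e] about [phi0], the limit is within [e] of [phi0] in norm; this
    gives first its boundedness, then convergence in norm. *)
Lemma Edual_complete (R : realType) (E : normedModType R)
    (F : set_system (@Edual R E)) : ProperFilter F -> cauchy F -> cvg F.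
Proof.
move=> FF /cauchy_ballP Fc.
have /cauchyP Fex : cauchy F by apply/cauchy_ballP.
have evP x : cvg (dual_fun phi x @[phi --> F]).
  apply/cauchy_cvgP/cauchy_exP => e e0.
  have d0 : 0 < e / (`|x| + 1) by rewrite divr_gt0// ltr_wpDl.
  have [phi0 Fphi0] := Fex _ d0; exists (dual_fun phi0 x).
  have : F [set phi | ball (dual_fun phi0 x) e (dual_fun phi x)]; last by [].
  apply: filterS Fphi0 => phi; rewrite /= -!ball_normE /ball_/= => phid.
  rewrite (_ : dual_fun phi0 x - dual_fun phi x = dual_fun (phi0 - phi) x)//.
  rewrite (le_lt_trans (dual_fun_le _ _))//.
  rewrite (@le_lt_trans _ _ (`|phi0 - phi| * (`|x| + 1)))//.
    by rewrite ler_wpM2l// lerDl.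
  by rewrite -ltr_pdivlMr// ltr_wpDl.
pose L x := lim (dual_fun phi x @[phi --> F]).
have Llin : scalar L.
  move=> a x y; apply: cvg_lim; first exact: Rhausdorff.
  rewrite (_ : (fun phi => _) = fun phi => a * dual_fun phi x + dual_fun phi y).
    by apply: cvgD; [apply: cvgMr|]; exact: evP.
  by apply/funext => phi; rewrite dual_funD dual_funZ.
have Lclose (e : R) phi0 : F (ball phi0 e) ->
    forall x, `|L x - dual_fun phi0 x| <= e * `|x|.
  move=> Fe x; rewrite distrC.
  have lim0 : `|dual_fun phi0 x - dual_fun phi x| @[phi --> F] -->
      `|dual_fun phi0 x - L x|.
    by apply: cvg_norm; apply: cvgB; [exact: cvg_cst|exact: evP].
  apply: (cvgr_to_le lim0); apply: filterS Fe => phi.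
  rewrite -ball_normE /ball_/= => /ltW phie.
  rewrite (_ : dual_fun phi0 x - dual_fun phi x = dual_fun (phi0 - phi) x)//.
  by rewrite (le_trans (dual_fun_le _ _))// ler_wpM2r.
have [phi1 F1] := Fex 1 ltac:(by []).
pose Lscalar : {scalar E} := HB.pack L (GRing.isLinear.Build _ _ _ _ _ Llin).
have Lelt : is_dual_elt L.
  apply: (@dual_eltP R E Lscalar (1 + `|phi1|)) => x /=.
  rewrite -[L x](subrK (dual_fun phi1 x)) (le_trans (ler_normD _ _))// mulrDl.
  by rewrite lerD// ?dual_fun_le// Lclose.
pose psi : @Edual R E := exist _ L Lelt.
apply/cvg_ex; exists psi; apply/cvgrPdist_le => e e0.
have [|phi0 F0] := Fex (e / 2); first by rewrite divr_gt0.
apply: filterS (F0) => phi; rewrite -ball_normE /ball_/= => /ltW phie.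
rewrite -[psi - phi](subrKA phi0) (le_trans (ler_normD _ _))//.
rewrite [e]splitr lerD//; apply: dual_norm_le; first by rewrite divr_ge0// ltW.
exact: Lclose.
Qed.

HB.instance Definition _ (R : realType) (E : normedModType R) :=
  Uniform_isComplete.Build (@Edual R E) (@Edual_complete R E).

HB.instance Definition _ (U V : completeType) := isPointed.Build (U * V)%type point.

(** Completeness of products is used twice: for Baire's theorem in [E * Edual], and for the convex
    series in the space containing the two epigraphs. *)
Lemma prod_complete (U V : completeType) (F : set_system (U * V)) :
  ProperFilter F -> cauchy F -> cvg F.
Proof.
move=> FF Fc.
have Uc : cvg (fst @ F).
  apply: cauchy_cvg => A entA.
  rewrite /= near_simpl -near2E near_map2.
  by apply: filterS (Fc _ (prod_entP entA (@entourageT V))) => -[p q] /= [].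
have Vc : cvg (snd @ F).
  apply: cauchy_cvg => A entA.
  rewrite /= near_simpl -near2E near_map2.
  by apply: filterS (Fc _ (prod_entP (@entourageT U) entA)) => -[p q] /= [].
apply/cvg_ex; exists (lim (fst @ F), lim (snd @ F)).
move=> A /(cvg_pair Uc Vc) FA.
by apply: (@filterS _ F _ _ A _ FA) => -[].
Qed.

HB.instance Definition _ (K : numFieldType) (U V : completeNormedModType K) :=
  Uniform_isComplete.Build (U * V)%type (@prod_complete U V).

(** * The duality argument *)

(** The restriction of [xi] to the first factor is itself [ys]; its restriction to the second lies
    in the bidual, where reflexivity provides [y]. *)
Lemma dual_prod_reflexive (R : realType) (E : normedModType R)
    (xi : {scalar (E * @Edual R E)%type}) (C : R) :
  @reflexive_space R E -> (forall u, `|xi u| <= C * `|u|) ->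
  exists (y : E) (ys : @Edual R E), forall x xs,
    xi (x, xs) = dual_fun ys x + dual_fun xs y.
Proof.
move=> Erefl xiC.
have lin1 : scalar (fun x : E => xi (x, 0)).
  by move=> a x y; rewrite -linearP; congr (xi (_, _)); rewrite /= scaler0 addr0.
pose xi1 : {scalar E} := HB.pack (fun x : E => xi (x, 0))
  (GRing.isLinear.Build _ _ _ _ _ lin1).
have xi1P : is_dual_elt xi1.
  apply: (@dual_eltP R E xi1 C) => x /=; rewrite (le_trans (xiC _))//.
  by rewrite prod_normE/= normr0 (max_idPl _).
have [y yP] : exists y : E, forall phi : @Edual R E, xi (0, phi) = dual_fun phi y.
  apply: (Erefl (fun phi => xi (0, phi))).
    move=> a phi psi chi chiE; rewrite -linearP; congr (xi (_, _)).
      by rewrite /= scaler0 addr0.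
    by apply: dual_fun_inj => z; rewrite chiE.
  exists C => phi; rewrite (le_trans (xiC _))//.
  by rewrite prod_normE/= normr0 (max_idPr _).
exists y, (exist _ _ xi1P) => x xs.
rewrite -yP /dual_fun /= -raddfD; congr (xi (_, _)).
  by rewrite addr0.
by rewrite add0r.
Qed.

Definition epi {R : realType} {E : normedModType R} (k : E -> @Edual R E -> \bar R) :=
  [set u : (E * @Edual R E) * R | (k u.1.1 u.1.2 <= u.2%:E)%E].

Lemma epi_closed (R : realType) (E : normedModType R)
    (k : E -> @Edual R E -> \bar R) :
  lsc_fun k -> closed (epi k).
Proof.
move=> klsc; rewrite -openC openE => -[[x xs] s] /= /negP; rewrite -ltNge => ks.
have [a sa ak] : exists2 a, s < a & (a%:E < k x xs)%E.
  move: ks; case: (k x xs) => [r||//]; last by exists (s + 1); rewrite ?ltrDl ?ltry.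
  rewrite lte_fin => /= sr; exists ((s + r) / 2); rewrite ?lte_fin; lra.
have [e e0 ke] := klsc _ _ _ ak.
(* [pdist] adds the two distances while the product ball takes their maximum, hence [e / 2]; the
   bound [a - s] keeps the height below [a]. *)
apply/nbhs_ballP; exists (Num.min (e / 2) (a - s)).
  by rewrite /= lt_min divr_gt0//= subr_gt0.
move=> [[y ys] t] [[/= xy xsys] st]; apply/negP; rewrite -ltNge.
apply: (@lt_trans _ _ a%:E).
  rewrite lte_fin; move: st; rewrite -ball_normE /ball_/= lt_min => /andP[_].
  by rewrite distrC => /ltr_normlW; rewrite ltrBlDr subrK.
apply: ke; rewrite /pdist /= [e]splitr ltrD//.
  by move: xy; rewrite -ball_normE /ball_/= lt_min distrC => /andP[].
by move: xsys; rewrite -ball_normE /ball_/= lt_min distrC => /andP[].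
Qed.

Lemma epi_segment_closed (R : realType) (E : normedModType R)
    (k : E -> @Edual R E -> \bar R) :
  convex_fun k -> segment_closed (epi k).
Proof.
move=> kcv t [[x xs] r] [[y ys] s] t01; rewrite /epi /= => kr ks.
have /andP[t0 t1] := t01.
apply: (le_trans (kcv _ _ _ _ xs ys _ t01 (erefl _) _)) => //.
rewrite -[leRHS]/(t%:E * r%:E + (1 - t)%:E * s%:E)%E.
by rewrite leeD// lee_pmul2l//= lte_fin subr_gt0.
Qed.

(** The hypothesis bounds the sum of the two conjugates, written with real heights to avoid infinite
    values. The suprema are taken one at a time: first over [f] with a point of [epi g] fixed, which
    also shows [f p1 p2] finite, then over [g]. The resulting bound on [f + g] forces equality in
    both inequalities [qf <= f] and [qf <= g]. *)
Lemma Pq_of_conjugate_sum_le (R : realType) (E : normedModType R)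
    (f g : E -> @Edual R E -> \bar R) (p1 r1 : E) (p2 r2 : @Edual R E) :
  BC_function f -> BC_function g ->
  (forall x xs s w ws t, (f x xs <= s%:E)%E -> (g w ws <= t%:E)%E ->
    dual_fun p2 x + dual_fun xs p1 + (dual_fun r2 w + dual_fun ws r1) <=
    s + t + (qf p1 p2 + qf r1 r2)) ->
  Pq f (p1, p2) /\ Pq g (r1, r2).
Proof.
move=> [[fNy _] [_ [fconj fq]]] [[gNy [w0 [ws0 gfin]]] [_ [gconj gq]]] fgle.
have f_le w ws t : (g w ws <= t%:E)%E ->
    (f p1 p2 <= (t + (qf p1 p2 + qf r1 r2) - (dual_fun r2 w + dual_fun ws r1))%:E)%E.
  move=> gt; apply: (le_trans (fconj _ _)); apply: ge_ereal_sup => _ [x _ [xs _ <-]].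
  have := fNy x xs; case fE: (f x xs) => [s||]// _; last by rewrite addeNy leNye.
  rewrite -EFinB lee_fin /Defs.dpair.
  have /fgle/(_ gt) : (f x xs <= s%:E)%E by rewrite fE.
  lra.
have [b bE] : exists b, g w0 ws0 = b%:E by exists (fine (g w0 ws0)); rewrite fineK.
have [al alE] : exists al, f p1 p2 = al%:E.
  have /f_le : (g w0 ws0 <= b%:E)%E by rewrite bE.
  by have := fNy p1 p2; case: (f p1 p2) => [al||]// _ _; exists al.
have g_le : (g r1 r2 <= (qf p1 p2 + qf r1 r2 - al)%:E)%E.
  apply: (le_trans (gconj _ _)); apply: ge_ereal_sup => _ [w _ [ws _ <-]].
  have := gNy w ws; case gE: (g w ws) => [t||]// _; last by rewrite addeNy leNye.
  have /f_le : (g w ws <= t%:E)%E by rewrite gE.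
  rewrite alE -EFinB !lee_fin /Defs.dpair; lra.
have := fq p1 p2; have := gq r1 r2; rewrite /Pq /= alE.
have := gNy r1 r2; move: g_le; case: (g r1 r2) => [be||]//.
by rewrite !lee_fin => ? _ ? ?; split; congr EFin; lra.
Qed.

(** This says that [A + e rho_1 B] is the whole space; the opposite signs come from [rho_1]. *)
Definition rho_sum_full {R : realType} {E : normedModType R} (e : R)
    (A B : set (E * @Edual R E)) :=
  forall a (as_ : @Edual R E), exists p q, [/\ A p, B q,
    a = p.1 - e *: q.1 & as_ = p.2 + e *: q.2].

Lemma sum_rho1_fullE (R : realType) (E : normedModType R)
    (A B : set (E * @Edual R E)) :
  sum_rho1_full A B <-> rho_sum_full 1 A B.
Proof.
split=> H a as_; have [p [q]] := H a as_.
  move=> [Ap [Bq [-> asE]]]; exists p, q; split => //; first by rewrite scale1r.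
  by apply: dual_fun_inj => z; rewrite asE scale1r.
by move=> [Ap Bq -> ->]; exists p, q; rewrite !scale1r.
Qed.

Lemma diff_rho1_fullE (R : realType) (E : normedModType R)
    (A B : set (E * @Edual R E)) :
  diff_rho1_full A B <-> rho_sum_full (-1) A B.
Proof.
split=> H a as_; have [p [q]] := H a as_.
  move=> [Ap [Bq [-> asE]]]; exists p, q; split => //.
    by rewrite scaleN1r opprK.
  by apply: dual_fun_inj => z; rewrite asE scaleN1r.
by move=> [Ap Bq -> ->]; exists p, q; rewrite !scaleN1r opprK.
Qed.

(** * Constraint map and objective of the convex program *)

Section rho_sum.
Context {R : realType} {E : completeNormedModType R}.
Local Notation X := (E * @Edual R E)%type.
Local Notation Y := ((X * R) * (X * R))%type.

Definition rho_sum_fun (e : R) (y : Y) : X :=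
  (y.1.1.1 - e *: y.2.1.1, y.1.1.2 + e *: y.2.1.2).

Lemma rho_sum_fun_linear e : linear (rho_sum_fun e).
Proof.
move=> a x y; congr pair => /=.
  by rewrite scalerBr !scalerDr !scalerA [a * e]mulrC opprD addrACA.
by rewrite !scalerDr !scalerA [a * e]mulrC addrACA.
Qed.

Lemma rho_sum_fun_continuous e : continuous (rho_sum_fun e).
Proof.
move=> y; apply: (@cvg_pair Y E (@Edual R E) (nbhs y)
    (nbhs (y.1.1.1 - e *: y.2.1.1)) (nbhs (y.1.1.2 + e *: y.2.1.2)) _ _ _
    (fun y : Y => y.1.1.1 - e *: y.2.1.1) (fun y : Y => y.1.1.2 + e *: y.2.1.2)).
  apply: cvgB; last apply: cvgZr.
    exact: (cvg_comp _ _ (cvg_comp _ _ cvg_fst cvg_fst) cvg_fst).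
  exact: (cvg_comp _ _ (cvg_comp _ _ cvg_snd cvg_fst) cvg_fst).
apply: cvgD; last apply: cvgZr.
  exact: (cvg_comp _ _ (cvg_comp _ _ cvg_fst cvg_fst) cvg_snd).
exact: (cvg_comp _ _ (cvg_comp _ _ cvg_snd cvg_fst) cvg_snd).
Qed.

(** The constant of the affine function is left out to keep the objective linear; it returns as the
    lower bound [- dual_fun as_ a]. *)
Definition rho_sum_obj (a : E) (as_ : @Edual R E) (y : Y) : R :=
  y.1.2 + y.2.2 - (dual_fun as_ y.1.1.1 + dual_fun y.1.1.2 a).

Lemma rho_sum_obj_scalar a as_ : scalar (rho_sum_obj a as_).
Proof.
move=> c x y; rewrite /rho_sum_obj /= dual_funD dual_funZ.
rewrite /GRing.scale/=; ring.
Qed.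

Lemma eval_continuous (a : E) : continuous (fun phi : @Edual R E => dual_fun phi a).
Proof.
have evlin : scalar (fun phi : @Edual R E => dual_fun phi a) by [].
pose ev : {scalar @Edual R E} := HB.pack (fun phi : @Edual R E => dual_fun phi a)
  (GRing.isLinear.Build _ _ _ _ _ evlin).
apply: (@dual_eltP R (@Edual R E) ev `|a| _).2 => phi.
by rewrite mulrC; exact: dual_fun_le.
Qed.

Lemma rho_sum_obj_continuous a as_ : continuous (rho_sum_obj a as_).
Proof.
move=> y; apply: cvgB; apply: cvgD.
- exact: (cvg_comp _ _ cvg_fst cvg_snd).
- exact: (cvg_comp _ _ cvg_snd cvg_snd).
- apply: (@continuous_comp _ _ _ (fun y : Y => y.1.1.1) (dual_fun as_));
    last exact: dual_fun_continuous.
  exact: (cvg_comp _ _ (cvg_comp _ _ cvg_fst cvg_fst) cvg_fst).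
- apply: (@continuous_comp _ _ _ (fun y : Y => y.1.1.2)
    (fun phi : @Edual R E => dual_fun phi a)); last exact: eval_continuous.
  exact: (cvg_comp _ _ (cvg_comp _ _ cvg_fst cvg_fst) cvg_snd).
Qed.

End rho_sum.

Lemma rho_sum_full_Pq (R : realType) (E : completeNormedModType R) (e : R)
    (f g : E -> @Edual R E -> \bar R) :
  e * e = 1 -> @reflexive_space R E ->
  BC_function f -> lsc_fun f -> BC_function g -> lsc_fun g ->
  rho_sum_full e (domf f) (domf g) -> rho_sum_full e (Pq f) (Pq g).
Proof.
move=> ee Erefl fBC flsc gBC glsc full a as_.
have [_ [fcv [_ fq]]] := fBC; have [_ [gcv [_ gq]]] := gBC.
pose X := (E * @Edual R E)%type; pose Y := ((X * R) * (X * R))%type.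
pose K := [set y : Y | epi f y.1 /\ epi g y.2].
pose T : {linear Y -> X} := HB.pack (rho_sum_fun e)
  (GRing.isLinear.Build _ _ _ _ _ (rho_sum_fun_linear e)).
pose phi : {scalar Y} := HB.pack (rho_sum_obj a as_)
  (GRing.isLinear.Build _ _ _ _ _ (rho_sum_obj_scalar a as_)).
have Kcl : closed K.
  apply: closedI; apply: preimage_closed; try exact: epi_closed.
    by move=> y _; exact: cvg_fst.
  by move=> y _; exact: cvg_snd.
have Kcv : segment_closed K.
  move=> t y z t01 [fy gy] [fz gz].
  by split; [exact: epi_segment_closed|exact: epi_segment_closed].
(* The domain hypothesis enters here, the finite values of [f] and [g] serving as heights. *)
have Tfull x : exists2 y, K y & T y = x.
  case: x => b bs; have [[p1 p2] [[q1 q2] [/= fp gq' -> ->]]] := full b bs.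
  exists (((p1, p2), fine (f p1 p2)), ((q1, q2), fine (g q1 q2))) => //.
  by split; rewrite /epi /= fineK.
have Kpos y : K y -> T y = (a, as_) -> - dual_fun as_ a <= phi y.
  case: y => -[[x xs] s] [[w ws] t] [/= fs gt] [<- <-].
  have := le_trans (fq _ _) fs; have := le_trans (gq _ _) gt.
  rewrite !lee_fin /qf /Defs.dpair /= /rho_sum_obj /=.
  rewrite !dual_funD !dual_funN !dual_funZ.
  move=> ? ?.
  have : e * (e * dual_fun ws w) = dual_fun ws w by rewrite mulrA ee mul1r.
  lra.
have [xi [C xiC] xi_le] := @closed_convex_multiplier R Y X T phi K (a, as_)
  (- dual_fun as_ a) (rho_sum_fun_continuous e) (rho_sum_obj_continuous a as_)
  Kcl Kcv Tfull Kpos.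
have [y [ys xiE]] := @dual_prod_reflexive R E xi C Erefl xiC.
(* These points are the coefficients of [(x, xs)] and [(w, ws)] in the multiplier inequality once
   its terms are collected. In the sum of their pairings [dual_fun ys y] cancels, leaving exactly
   the constant of that inequality. *)
exists (y + a, ys + as_), (e *: y, - (e *: ys)).
have [fP gP] : Pq f (y + a, ys + as_) /\ Pq g (e *: y, - (e *: ys)).
  apply: Pq_of_conjugate_sum_le => // x xs s w ws t fs gt.
  have := xi_le (((x, xs), s), ((w, ws), t)) (conj fs gt).
  rewrite xiE /= /rho_sum_obj /= /qf /Defs.dpair.
  rewrite !dual_funD !dual_funN !dual_funZ.
  have : e * (e * dual_fun ys y) = dual_fun ys y by rewrite mulrA ee mul1r.
  lra.
split => //=; first by rewrite scalerA ee scale1r [y + a]addrC addrK.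
by rewrite scalerN scalerA ee scale1r [ys + as_]addrC addrK.
Qed.

Lemma rho_sum_full_subset (R : realType) (E : normedModType R) (e : R)
    (A B A' B' : set (E * @Edual R E)) :
  A `<=` A' -> B `<=` B' -> rho_sum_full e A B -> rho_sum_full e A' B'.
Proof.
move=> AA' BB' full a as_; have [p [q [Ap Bq -> ->]]] := full a as_.
by exists p, q; split => //; [exact: AA'|exact: BB'].
Qed.

Lemma Pq_domf (R : realType) (E : normedModType R) (k : E -> @Edual R E -> \bar R) :
  Pq k `<=` domf k.
Proof. by move=> p; rewrite /Pq /domf /= => ->. Qed.

Theorem theorem7p1 (R : realType) (E : completeNormedModType R)
  (f g : E -> @Edual R E -> \bar R) :
  (exists x : E, x != 0) ->
  @reflexive_space R E ->
  BC_function f -> lsc_fun f ->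
  BC_function g -> lsc_fun g ->
  (sum_rho1_full (domf f) (domf g) <-> sum_rho1_full (Pq f) (Pq g)) /\
  (diff_rho1_full (domf f) (domf g) <-> diff_rho1_full (Pq f) (Pq g)).
Proof.
move=> _ Erefl fBC flsc gBC glsc.
have main e : e * e = 1 ->
    rho_sum_full e (domf f) (domf g) <-> rho_sum_full e (Pq f) (Pq g).
  move=> ee; split; first exact: rho_sum_full_Pq.
  by apply: rho_sum_full_subset; exact: Pq_domf.
rewrite !sum_rho1_fullE !diff_rho1_fullE.
by split; apply: main; rewrite ?mulr1// mulrNN mulr1.
Qed.
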